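(* Let $G$ and $H$ be Polish groups and let $B\subseteq G\times H$ be a Borel set. Consider the conditions: (1) there exist a Haar meager set $E\subseteq H$, a nonempty compact metric space $K$ and a continuous function $f:K\to G$ such that every $h\in H\setminus E$ and every $g_1,g_2\in G$ satisfy that $f^{-1}(g_1B^hg_2)$ is meager in $K$; (2) $B$ is Haar meager in the group $G\times H$; (3) there exists a Haar meager set $E\subseteq H$ such that for every $h\in H\setminus E$ the section $B^h$ is meager in $G$. Then (1) implies (2) (for arbitrary Polish $G$). If moreover $G$ is locally compact, then (1), (2) and (3) are all equivalent.
   Context: A Polish group is a topological group whose topology is separable and completely metrizable; $G\times H$ carries the product group structure and topology. A set $A$ in a Polish group $\Gamma$ is Haar meager if there are a Borel set $B'\supseteq A$, a nonempty compact metric space $L$ and a continuous function $\phi:L\to\Gamma$ such that $\phi^{-1}(xB'y)$ is meager in $L$ for all $x,y\in\Gamma$. For $h\in H$, $B^h=\{g\in G:(g,h)\in B\}$. *)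

(* Defs.v *)
From HB Require Import structures.
From mathcomp Require Import all_boot all_order all_algebra.
From mathcomp Require Import all_classical all_reals all_analysis.
From mathcomp Require Import Rstruct Rstruct_topology.
Set Implicit Arguments. Unset Strict Implicit. Unset Printing Implicit Defensive.
Import Order.TTheory GRing.Theory Num.Theory.
Local Open Scope classical_set_scope.
Local Open Scope ring_scope.

Definition nowhere_dense (T : topologicalType) (A : set T) :=
  interior (closure A) = set0.

Definition meager (T : topologicalType) (A : set T) :=
  exists F : nat -> set T, (forall n, nowhere_dense (F n)) /\ A `<=` \bigcup_n F n.

Definition Borel (T : topologicalType) (A : set T) := <<s open >> A.

Definition complete_compatible_metric (T : topologicalType)
    (d : T -> T -> Rdefinitions.R) :=
  [/\ (forall x y, d x y = 0 <-> x = y),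
      (forall x y, d x y = d y x),
      (forall x y z, d x z <= d x y + d y z),
      (forall A : set T, open A <->
         (forall x, A x -> exists2 e : Rdefinitions.R, 0 < e &
             [set y | d x y < e] `<=` A)) &
      (forall u : nat -> T,
         (forall e : Rdefinitions.R, 0 < e ->
            exists N, forall m n, (N <= m)%N -> (N <= n)%N -> d (u m) (u n) < e) ->
         exists x : T, u @ \oo --> x)].

Record polish_group (T : topologicalType) := PolishGroup {
  pg_mul : T -> T -> T;
  pg_inv : T -> T;
  pg_one : T;
  pg_mulA : associative pg_mul;
  pg_mul1g : left_id pg_one pg_mul;
  pg_mulVg : left_inverse pg_one pg_inv pg_mul;
  pg_mul_cont : continuous (fun p : T * T => pg_mul p.1 p.2);
  pg_inv_cont : continuous pg_inv;
  pg_separable : exists2 D : set T, countable D & dense D;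
  pg_complete_metrizable : exists d, @complete_compatible_metric T d
}.

Definition prod_mul (G H : topologicalType) (PG : polish_group G)
    (PH : polish_group H) (p q : G * H) : G * H :=
  (pg_mul PG p.1 q.1, pg_mul PH p.2 q.2).

Definition translate (T : Type) (mul : T -> T -> T) (x : T) (A : set T) (y : T)
  : set T := [set mul (mul x a) y | a in A].

Definition nonempty_compact_metric (K : pseudoMetricType Rdefinitions.R) :=
  [/\ [set: K] !=set0, compact [set: K] & hausdorff_space K].

Definition haar_meager (T : topologicalType) (mul : T -> T -> T) (A : set T) :=
  exists2 B' : set T, Borel B' /\ A `<=` B' &
  exists (L : pseudoMetricType Rdefinitions.R) (phi : L -> T),
    [/\ nonempty_compact_metric L, continuous phi &
        forall x y : T, meager (phi @^-1` translate mul x B' y)].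

Definition hsection (G H : Type) (B : set (G * H)) (h : H) : set G :=
  [set g | B (g, h)].

(* Main.v *)
(** The Kuratowski-Ulam theorem drives both directions. If [f : K -> G] works
    for the sections of [B] off [E] and [phi : L -> H] witnesses that [E] is Haar
    meager, then [f * phi] witnesses that [B] is: off a meager set of [l] the
    section at [l] of the preimage of a translate of [B] is meager in [K].
    Conversely, let [phi : L -> G * H] witness that [B] is Haar meager, [B]
    Borel. All sections of [{(l, g) | phi l \in (g, x) B (1, y)}] at fixed [g]
    are meager, so for almost all [l] the sections at [l] are meager; up to
    homeomorphism these are sections of [B]. Hence [snd \o phi] witnesses that
    [E = {h | B^h is not meager}], which is Borel, is Haar meager. If [G] is
    locally compact, the closure of an open relatively compact set meets every
    meager set of [G] in a relatively meager set, so meager sections suffice. *)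
Require Import Defs.
From HB Require Import structures.
From mathcomp Require Import all_boot all_order all_algebra.
From mathcomp Require Import all_classical all_reals all_analysis.
From mathcomp Require Import Rstruct Rstruct_topology.
Import Order.TTheory GRing.Theory Num.Theory.
Set Implicit Arguments.
Unset Strict Implicit.
Local Open Scope classical_set_scope.

(** * Baire category and Borel sets *)

Definition baire_space (T : topologicalType) :=
  forall A : set T, meager A -> A° = set0.

Section Category.
Context {T : topologicalType}.
Implicit Types A B U : set T.

Lemma nowhere_denseS A B : A `<=` B -> nowhere_dense B -> nowhere_dense A.
Proof.
by move=> AB; rewrite /nowhere_dense -!subset0; apply: subset_trans;
  exact/interiorS/closureS.
Qed.

Lemma closed_nowhere_dense A : closed A ->
  (forall U, open U -> U `<=` A -> U = set0) -> nowhere_dense A.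
Proof.
move=> /closure_id cA h; rewrite /nowhere_dense -cA.
by apply: h; [exact: open_interior|exact: interior_subset].
Qed.

Lemma nowhere_dense_open_sub A U :
  nowhere_dense A -> open U -> U `<=` closure A -> U = set0.
Proof.
move=> ndA oU UA; rewrite -subset0 -ndA -(interior_id U).1//.
exact: interiorS.
Qed.

Lemma meagerS A B : A `<=` B -> meager B -> meager A.
Proof.
by move=> AB [F [ndF BF]]; exists F; split=> //; exact: subset_trans BF.
Qed.

Lemma nowhere_dense_meager A : nowhere_dense A -> meager A.
Proof. by move=> ndA; exists (fun=> A); split=> // x Ax; exists 0%N. Qed.

Lemma meager0 : meager (@set0 T).
Proof.
by apply: nowhere_dense_meager; rewrite /nowhere_dense closure0 interior0.
Qed.

Lemma meager_bigcup (F : nat -> set T) :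
  (forall n, meager (F n)) -> meager (\bigcup_n F n).
Proof.
move=> /choice[G hG].
(* [unpickle] enumerates the pairs of indices; numbers that code no pair get the empty set. *)
exists (fun n => if unpickle n is Some (i, j) then G i j else set0); split.
  move=> n; case: unpickle => [[i j]|]; first exact: (hG i).1.
  by rewrite /nowhere_dense closure0 interior0.
move=> x [i _ /(hG i).2[j _ Gx]].
by exists (pickle (i, j)) => //; rewrite pickleK.
Qed.

Lemma meagerU A B : meager A -> meager B -> meager (A `|` B).
Proof.
move=> mA mB; apply: (@meagerS _ (\bigcup_n (if n is 0%N then A else B))).
  by move=> x [Ax|Bx]; [exists 0%N|exists 1%N].
by apply: meager_bigcup; case.
Qed.

Lemma baire_open_nonmeager U : baire_space T -> open U -> meager U -> U = set0.
Proof.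
move=> bT /interior_id <- /bT; rewrite (interior_id _).1//.
exact: open_interior.
Qed.

Definition baire_property A :=
  exists U, [/\ open U, meager (A `\` U) & meager (U `\` A)].

Lemma open_baire_property U : open U -> baire_property U.
Proof. by move=> oU; exists U; rewrite setDv; split=> //; exact: meager0. Qed.

(** If [A] equals the open set [U] up to meager sets, its complement equals the exterior of [U] up
    to meager sets, because the boundary of an open set is nowhere dense. *)
Lemma baire_propertyC A : baire_property A -> baire_property (~` A).
Proof.
move=> [U [oU AU UA]]; exists (~` closure U).
have mb : meager (closure U `\` U).
  apply/nowhere_dense_meager/closed_nowhere_dense.
    by apply: closedI; [exact: closed_closure|exact: open_closedC].
  move=> V oV VU; rewrite -subset0 => x Vx.
  have [clx _] := VU _ Vx.
  have [y [Uy Vy]] := clx V (open_nbhs_nbhs (conj oV Vx)).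
  by have [_] := VU _ Vy.
split; first exact/closed_openC/closed_closure.
- apply: meagerS (meagerU UA mb) => x [/= nA /contrapT clU].
  by have [Ux|nU] := pselect (U x); [left|right].
- apply: meagerS AU => x [/= nU /contrapT Ax]; split=> // Ux.
  exact/nU/subset_closure.
Qed.

Lemma baire_property_bigcup (F : nat -> set T) :
  (forall n, baire_property (F n)) -> baire_property (\bigcup_n F n).
Proof.
move=> /choice[U hU]; exists (\bigcup_n U n); split.
- by apply: bigcup_open => n _; have [] := hU n.
- apply: (@meagerS _ (\bigcup_n (F n `\` U n))).
    move=> x [[n _ Fx] nU]; exists n => //; split=> // Ux.
    by apply: nU; exists n.
  by apply: meager_bigcup => n; have [] := hU n.
- apply: (@meagerS _ (\bigcup_n (U n `\` F n))).
    move=> x [[n _ Ux] nF]; exists n => //; split=> // Fx.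
    by apply: nF; exists n.
  by apply: meager_bigcup => n; have [] := hU n.
Qed.

Lemma Borel_ind (P : set T -> Prop) : P set0 ->
  (forall U, open U -> P U) -> (forall A, P A -> P (~` A)) ->
  (forall F : nat -> set T, (forall n, P (F n)) -> P (\bigcup_n F n)) ->
  forall A, Borel A -> P A.
Proof.
move=> P0 Popen PC Pbig.
have sP : sigma_algebra setT P by split=> // B PB; rewrite setTD; exact: PC.
exact: (smallest_sub sP Popen).
Qed.

Lemma open_Borel U : open U -> Borel U.
Proof. exact: sub_sigma_algebra. Qed.

Lemma BorelC A : Borel A -> Borel (~` A).
Proof. by move=> BA; rewrite -setTD; exact: sigma_algebraCD. Qed.

Lemma Borel_bigcup (F : nat -> set T) :
  (forall n, Borel (F n)) -> Borel (\bigcup_n F n).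
Proof. exact: sigma_algebra_bigcup. Qed.

Lemma Borel_baire_property A : Borel A -> baire_property A.
Proof.
apply: Borel_ind A; [exact/open_baire_property/open0|exact: open_baire_property
  |exact: baire_propertyC|exact: baire_property_bigcup].
Qed.

Lemma second_countable_seq : @second_countable T -> exists V : nat -> set T,
  (forall n, open (V n)) /\
  forall U x, open U -> U x -> exists n, V n x /\ V n `<=` U.
Proof.
move=> [B /countable_injP[f finj] [oB bB]].
(* [f] is injective on the base, so the set of index [n] is the base member with code [n], or empty
   when there is none. *)
exists (fun n => \bigcup_(U in B `&` f @^-1` [set n]) U); split.
  by move=> n; apply: bigcup_open => U [/oB].
move=> U x oU Ux; have [W [BW Wx] WU] := bB x U (open_nbhs_nbhs (conj oU Ux)).
exists (f W); split; first by exists W.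
move=> y [W' [BW' /= fW'] W'y]; apply: WU.
by rewrite -(finj W' W) ?inE.
Qed.
End Category.

(** * The Kuratowski-Ulam theorem *)

Lemma Borel_preimage (S T : topologicalType) (f : S -> T) (A : set T) :
  continuous f -> Borel A -> Borel (f @^-1` A).
Proof.
move=> cf; move: A; apply: Borel_ind.
- rewrite preimage_set0; apply: open_Borel; exact: open0.
- by move=> U oU; apply: open_Borel; apply: open_comp => // x _; exact: cf.
- by move=> A; rewrite preimage_setC; exact: BorelC.
- by move=> F BF; rewrite preimage_bigcup; exact: Borel_bigcup.
Qed.

Lemma meager_preimage (S T : topologicalType) (f : S -> T) (g : T -> S)
    (A : set T) :
  continuous f -> continuous g -> cancel f g -> cancel g f ->
  meager A -> meager (f @^-1` A).
Proof.
move=> cf cg fK gK [F [ndF AF]].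
exists (fun n => f @^-1` F n); split; last first.
  by move=> x /AF[n _ Fx]; exists n.
move=> n; apply: (@nowhere_denseS _ _ (f @^-1` closure (F n))).
  by move=> x Fx; exact: subset_closure.
apply: closed_nowhere_dense.
  apply: preimage_closed; last exact: closed_closure.
  by move=> x _; exact: cf.
move=> U oU UF.
have oV : open (g @^-1` U) by apply: open_comp => // x _; exact: cg.
have V0 : g @^-1` U = set0.
  by apply: nowhere_dense_open_sub (ndF n) oV _ => y /= /UF/=; rewrite gK.
move: V0; rewrite -!subset0 => V0 x Ux.
by apply: (V0 (f x)); rewrite /= fK.
Qed.

Section KuratowskiUlam.
Context {X Y : topologicalType}.
Implicit Types A : set (X * Y).

Lemma pairl_continuous (y : Y) : continuous (fun x : X => (x, y)).
Proof. by move=> x; apply: cvg_pair; [exact: cvg_id|exact: cvg_cst]. Qed.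

Lemma pairr_continuous (x : X) : continuous (fun y : Y => (x, y)).
Proof. by move=> y; apply: cvg_pair; [exact: cvg_cst|exact: cvg_id]. Qed.

Lemma hsection_Borel A y : Borel A -> Borel (hsection A y).
Proof. by apply: Borel_preimage; exact: pairl_continuous. Qed.

Lemma meager_hsection A : @second_countable X -> meager A ->
  meager [set y | ~ meager (hsection A y)].
Proof.
move=> /second_countable_seq[V [oV bV]] [F [ndF AF]].
(* For each nonempty [V n], the [y] whose section contains it form a closed set
   with empty interior. *)
pose D k n := [set y | V n !=set0 /\ V n `<=` hsection (closure (F k)) y].
apply: (@meagerS _ _ (\bigcup_k \bigcup_n D k n)).
  move=> y /=; apply: contra_notP => nD.
  exists (fun k => hsection (F k) y); split; last first.
    by move=> x /AF[k _ Fx]; exists k.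
  move=> k; apply: (@nowhere_denseS _ _ (hsection (closure (F k)) y)).
    by move=> x Fx; exact: subset_closure.
  apply: closed_nowhere_dense.
    apply: (@preimage_closed _ _ (fun x : X => (x, y))).
      by move=> x _; exact: pairl_continuous.
    exact: closed_closure.
  move=> U oU UF; rewrite -subset0 => x Ux; apply: nD.
  have [n [Vx VU]] := bV U x oU Ux.
  exists k => //; exists n => //; split; first by exists x.
  exact: subset_trans UF.
apply: meager_bigcup => k; apply: meager_bigcup => n.
have [[x0 Vx0]|V0] := pselect (V n !=set0); last first.
  by apply: meagerS meager0 => y [].
apply/nowhere_dense_meager/closed_nowhere_dense.
  have -> : D k n = \bigcap_(x in V n) [set y | closure (F k) (x, y)].
    apply/seteqP; split=> [y [_ VF] x Vx|y h]; first exact: VF.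
    by split; [exists x0|move=> x /h].
  apply: closed_bigI => x _; apply: preimage_closed; last exact: closed_closure.
  by move=> y _; exact: pairr_continuous.
(* Otherwise the closure of the nowhere dense [F k] would contain the nonempty open rectangle with
   sides [V n] and [U]. *)
move=> U oU UD; rewrite -subset0 => y Uy.
have [[x Vx] _] := UD _ Uy.
have oVU : open (V n `*` U).
  rewrite openE => -[a b] [/= Va Ub].
  by exists (V n, U) => //; split; apply: open_nbhs_nbhs; split=> //; exact: oV.
have VU0 : V n `*` U = set0.
  apply: (nowhere_dense_open_sub (ndF k) oVU) => -[a b] [/= Va Ub].
  by have [_] := UD _ Ub; exact.
by suff : (V n `*` U) (x, y) by rewrite VU0.
Qed.

(** [A] equals an open [U] up to meager sets. If [U] contained a nonempty open rectangle with sides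
    [P] and [Q], then for each [b] in [Q] the sections at [b] of [A] and of [U] minus [A] would
    cover [P], so one of them would be nonmeager. Both kinds of [b] form meager sets, against the
    Baire property of the space [Y]. *)
Lemma meager_of_hsection A : @second_countable X -> baire_space X ->
  baire_space Y -> baire_property A ->
  meager [set y | ~ meager (hsection A y)] -> meager A.
Proof.
move=> cX bX bY [U [oU AU UA]] mA.
suff U0 : U = set0 by move: AU; rewrite U0 setD0.
rewrite -subset0 => -[x y] Uxy.
have [[P Q]/= [nP nQ] PQU] : nbhs (x, y) U by exact: open_nbhs_nbhs.
suff : Q° = set0 by rewrite -subset0 => /(_ y); exact.
apply: baire_open_nonmeager => //; first exact: open_interior.
apply: (@meagerS _ _ ([set y | ~ meager (hsection A y)] `|`
  [set y | ~ meager (hsection (U `\` A) y)])).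
  move=> b /interior_subset Qb /=; apply/not_andP => -[mAb mUb].
  have : P° = set0.
    apply: (baire_open_nonmeager bX); first exact: open_interior.
    apply: meagerS (meagerU mAb mUb) => a /interior_subset Pa.
    have Uab : U (a, b) by exact: PQU.
    by have [Aab|nAab] := pselect (A (a, b)); [left|right].
  by rewrite -subset0 => /(_ x); exact.
by apply: meagerU => //; exact: meager_hsection.
Qed.

(** Localizing to every open [U] is what lets the induction over Borel sets pass through
    complements. *)
Lemma Borel_nonmeager_hsection A U : @second_countable X -> baire_space X ->
  Borel A -> open U -> Borel [set y | ~ meager (hsection A y `&` U)].
Proof.
move=> /second_countable_seq[V [oV bV]] bX BA.
(* Borelness is carried along because the complement step uses the Baire property of sections. *)
suff [_] : Borel A /\
  forall U, open U -> Borel [set y | ~ meager (hsection A y `&` U)] by exact.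
move: A BA {U}; apply: Borel_ind.
- split=> [|U _]; first by apply: open_Borel; exact: open0.
  rewrite (_ : [set _ | _] = set0); first by apply: open_Borel; exact: open0.
  rewrite -subset0 => y; apply.
  by rewrite (_ : _ `&` _ = set0) -?subset0; [exact: meager0|move=> x []].
- move=> A oA; split=> [|U oU]; first exact: open_Borel.
  apply: open_Borel.
  (* Sections of an open set are open, so in the Baire space [X] nonmeager means nonempty, and the
     set becomes a projection of an open set. *)
  rewrite (_ : [set _ | _] = snd @` (A `&` fst @^-1` U)).
    apply: snd_open; apply: openI => //; apply: open_comp => // p _.
    exact: cvg_fst.
  apply/seteqP; split=> [y nm|_ [[x y] [/= Axy Ux] <-] m].
    have /set0P[x [Ax Ux]] : hsection A y `&` U != set0.
      by apply/eqP => h; apply: nm; rewrite h; exact: meager0.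
    by exists (x, y).
  have : hsection A y `&` U = set0.
    apply: baire_open_nonmeager => //; apply: openI => //.
    apply: (@open_comp _ _ (fun x : X => (x, y))) => // z _.
    exact: pairl_continuous.
  by rewrite -subset0 => /(_ x); exact.
- (* By the Baire property, a set is nonmeager in [U] iff its complement is
     meager in some nonempty basic open subset of [U]. *)
  move=> A [BA IH]; split=> [|U oU]; first exact: BorelC.
  rewrite (_ : [set _ | _] = \bigcup_(n in [set n | V n !=set0 /\ V n `<=` U])
      ~` [set y | ~ meager (hsection A y `&` V n)]).
    rewrite bigcup_mkcond; apply: Borel_bigcup => n; case: ifP => _.
      by apply: BorelC; exact: IH.
    by apply: open_Borel; exact: open0.
  apply/seteqP; split=> [y nm|y [n [[x Vx] VU]]].
    have /Borel_baire_property[W [oW AW WA]] := hsection_Borel y (BorelC BA).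
    have /set0P[x [Wx Ux]] : W `&` U != set0.
      apply/eqP => WU0; apply: nm; apply: meagerS AW => x [Ax Ux].
      by split=> // Wx; suff : (W `&` U) x by rewrite WU0.
    have [n [Vx VWU]] := bV _ x (openI oW oU) (conj Wx Ux).
    exists n; first by split; [exists x|move=> z /VWU[]].
    move=> /= nmV; apply: nmV.
    by apply: (meagerS _ WA) => z [Az /VWU[Wz _]]; split=> //; apply.
  move=> /= /contrapT mA mAC.
  suff : V n = set0 by rewrite -subset0 => /(_ x); exact.
  apply: (baire_open_nonmeager bX); first exact: oV.
  apply: meagerS (meagerU mA mAC) => z Vz.
  have [Az|nAz] := pselect (A (z, y)); [left|right]; split=> //; exact: VU.
- move=> F IH; split=> [|U oU].
    by apply: Borel_bigcup => n; have [] := IH n.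
  rewrite (_ : [set _ | _] =
    \bigcup_n [set y | ~ meager (hsection (F n) y `&` U)]).
    by apply: Borel_bigcup => n; have [_] := IH n; exact.
  apply/seteqP; split=> [y|y [n _]].
    apply: contra_notP => h.
    apply: (@meagerS _ _ (\bigcup_n (hsection (F n) y `&` U))).
      by move=> x [[n _ Fx] Ux]; exists n.
    apply: meager_bigcup => n; apply: contrapT => nm; apply: h.
    by exists n.
  apply: contra_not; apply: meagerS => x [Fx Ux]; split=> //.
  by exists n.
Qed.
End KuratowskiUlam.

(** * Complete and compact pseudometric spaces *)

Local Open Scope ring_scope.

Section PseudoMetric.
Context {R : realType}.
Implicit Types M : pseudoMetricType R.

(** Sequential, as in [complete_compatible_metric], so that completeness of a metric carries over
    unchanged. *)
Definition cauchy_complete M := forall u : nat -> M,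
  (forall e : R, 0 < e -> exists N, forall m n,
    (N <= m)%N -> (N <= n)%N -> ball (u m) e (u n)) ->
  exists x : M, u @ \oo --> x.

Lemma compact_cauchy_complete M : compact [set: M] -> cauchy_complete M.
Proof.
move=> cM u cu.
(* A cluster point of a Cauchy sequence is its limit. *)
have [x [_ clx]] := cM (u @ \oo) _ filterT.
exists x; apply/cvg_ballP => e e0.
have [N hN] := cu _ (divr_gt0 e0 (@ltr0n R 2)).
have uN : (u @ \oo) (u @` [set n | (N <= n)%N]).
  by exists N => // n /= Nn; exists n.
have [_ [[m /= Nm <-] xm]] :=
  clx _ _ uN (nbhsx_ballx x _ (divr_gt0 e0 (@ltr0n R 2))).
exists N => // n /= Nn; apply: ball_split xm _; exact: hN.
Qed.

Lemma compact_pseudometric_second_countable M :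
  [set: M] !=set0 -> compact [set: M] -> @second_countable M.
Proof.
move=> [x0 _] cM.
(* A base point makes [M] a pointed space, the setting of [compact_second_countable]. *)
pose P : pseudoPMetricType R := HB.pack (M : Type)
  (PseudoMetric.class M) (isPointed.Build M x0).
exact: (@compact_second_countable R P cM).
Qed.

Lemma separable_second_countable M (D : set M) :
  countable D -> dense D -> @second_countable M.
Proof.
move=> cD dD.
(* Interiors are taken since balls of a [pseudoMetricType] need not be open. *)
pose f n (z : M) := (ball z n.+1%:R^-1)°.
exists (\bigcup_n (f n @` D)).
  apply: bigcup_countable => // n _.
  exact: card_le_trans (card_image_le _ _) cD.
split=> [_ [n _ [z _ <-]]|x V /nbhs_ballP[e /= e0 eV]].
  exact: open_interior.
have [//|N] := @ltr_add_invr R 0 (e / 2) _; first by rewrite divr_gt0.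
rewrite add0r => /ltW Ne.
have n0 : 0 < N.+1%:R^-1 :> R by rewrite invr_gt0.
(* [z] lies within half of the radius [N.+1%:R^-1] of [x], so [x] is interior to the ball of that
   radius around [z]; the radius is at most [e / 2], which keeps this ball inside [V]. *)
have [z [/interior_subset xz Dz]] : ((ball x (N.+1%:R^-1 / 2))° `&` D) !=set0.
  apply: dD; last exact: open_interior.
  by exists x; apply: nbhsx_ballx; rewrite divr_gt0.
exists (f N z); first split.
- by exists N => //; exists z.
- apply: filterS (nbhsx_ballx x _ (divr_gt0 n0 (@ltr0n R 2))) => y xy.
  exact: ball_splitr xz xy.
- move=> y /interior_subset zy; apply: eV; apply: (@ball_split _ _ z).
    apply: le_ball xz; rewrite ler_pdivrMr// (le_trans Ne)// ler_peMr ?ler1n//.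
    by rewrite ltW// divr_gt0.
  exact: le_ball zy.
Qed.

Lemma baire_category M : cauchy_complete M -> baire_space M.
Proof.
move=> cM A [F [ndF AF]]; rewrite -subset0 => x0 Ax0.
(* A pair is the center and radius of a ball. Asking the doubled ball to fit leaves room for the
   limit, which is only known to lie within twice each radius; the bound [n.+1%:R^-1] makes the
   centers Cauchy. Nothing is asked when the radius of [p] is not positive, so that the choice
   function is total. *)
pose step n (p q : M * R) := 0 < p.2 -> [/\ 0 < q.2, q.2 <= n.+1%:R^-1 &
  ball q.1 (q.2 *+ 2) `<=` ball p.1 p.2 `\` F n].
have stepP n p : exists q, step n p q.
  have [p0|] := ltP 0 p.2; last first.
    by move=> np0; exists p; rewrite /step ltNge np0.
  have [y [py nFy]] : ((ball p.1 p.2)° `\` closure (F n)) !=set0.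
    apply/set0P/eqP => h.
    have := nowhere_dense_open_sub (ndF n) (open_interior (ball p.1 p.2)).
    rewrite -subset0 => /(_ _ p.1); apply.
      move=> z pz; apply: contrapT => nz; move: h.
      by rewrite -subset0 => /(_ z); exact.
    exact: nbhsx_ballx.
  have : nbhs y (ball p.1 p.2 `\` F n).
    have : nbhs y ((ball p.1 p.2)° `&` ~` closure (F n)).
      apply: open_nbhs_nbhs; split=> //.
      apply: openI; first exact: open_interior.
      exact/closed_openC/closed_closure.
    apply: filterS.
    move=> z [/interior_subset pz nz]; split=> // Fz.
    by apply: nz; exact: subset_closure.
  move=> /nbhs_ballP[r /= r0 rF].
  exists (y, Num.min (r / 2) n.+1%:R^-1) => _; split => /=.
  - by rewrite lt_min divr_gt0//= invr_gt0.
  - by rewrite ge_min lexx orbT.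
  - apply: subset_trans rF; apply: le_ball.
    by rewrite /= [leRHS]splitr mulr2n lerD// ge_min lexx.
have /nbhs_ballP[r0 /= r0_gt0 r0A] : nbhs x0 A by [].
have [f hf] := choice (fun np : nat * (M * R) => stepP np.1 np.2).
pose p := fix p n := if n is n'.+1 then f (n', p n') else (x0, r0).
have p0 n : 0 < (p n).2 by elim: n => [|n IH] //=; have [] := hf (n, p n) IH.
have pS n : [/\ (p n.+1).2 <= n.+1%:R^-1 &
    ball (p n.+1).1 ((p n.+1).2 *+ 2) `<=` ball (p n).1 (p n).2 `\` F n].
  by have [] := hf (n, p n) (p0 n).
have le2 n : (p n).2 <= (p n).2 *+ 2 by rewrite mulr2n lerDl ltW.
have pmono k n : ball (p (n + k)%N).1 (p (n + k)%N).2 `<=` ball (p n).1 (p n).2.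
  elim: k => [|k IH]; first by rewrite addn0.
  rewrite addnS; apply: subset_trans IH => z /(le_ball (le2 _)).
  by move=> /(pS (n + k)%N).2[].
have pin m n : (n <= m)%N -> ball (p n).1 (p n).2 (p m).1.
  by move=> nm; rewrite -(subnKC nm); apply: pmono; exact: ballxx.
have [x px] : exists x : M, (fun n => (p n).1) @ \oo --> x.
  apply: cM => e e0.
  have [//|N] := @ltr_add_invr R 0 (e / 2) _; first by rewrite divr_gt0.
  rewrite add0r => Ne; exists N.+1 => m n Nm Nn.
  have h k : (N < k)%N -> ball (p N.+1).1 (e / 2) (p k).1.
    move=> Nk; apply: le_ball (pin _ _ Nk).
    by rewrite (le_trans (pS N).1)// ltW.
  by apply: ball_splitr (h _ Nm) (h _ Nn).
have xin n : ball (p n).1 ((p n).2 *+ 2) x.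
  have [N _ hN] := (@cvg_ballP R M nat \oo _ _ _).1 px _ (p0 n).
  rewrite mulr2n; apply: (@ball_triangle _ _ (p (maxn n N)).1).
    by apply: pin; rewrite leq_maxl.
  by apply: ball_sym; apply: hN; rewrite /= leq_maxr.
have /AF[n _ Fx] : A x.
  by apply: r0A; have [+ _] := (pS 0%N).2 _ (xin 1%N); exact.
by have [_] := (pS n).2 _ (xin n.+1).
Qed.
End PseudoMetric.

(** The equality of topological spaces allows [T] to be replaced by [M], which brings Polish groups
    under the results on pseudometric spaces. *)
Lemma pseudoMetric_of_metric (T : topologicalType)
    (d : T -> T -> Rdefinitions.R) : complete_compatible_metric d ->
  exists M : pseudoMetricType Rdefinitions.R,
    [/\ M = T :> topologicalType, cauchy_complete M & hausdorff_space M].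
Proof.
move=> [d0 dC dT dopen dcomplete].
pose b x (e : Rdefinitions.R) y := d x y < e.
have b_center x e : 0 < e -> b x e x by rewrite /b (d0 x x).2.
have b_sym x y e : b x e y -> b y e x by rewrite /b dC.
have b_tri x y z e1 e2 : b x e1 y -> b y e2 z -> b x (e1 + e2) z.
  by move=> h1 h2; apply: le_lt_trans (dT x y z) _; exact: ltrD.
have nbhsP x A : nbhs x A <-> exists2 e, 0 < e & b x e `<=` A.
  split=> [|[e e0 eA]].
    rewrite nbhsE => -[U [oU Ux] UA].
    have [e e0 eU] := (dopen U).1 oU x Ux.
    by exists e => //; exact: subset_trans UA.
  apply: filterS eA _; apply: open_nbhs_nbhs; split; last exact: b_center.
  apply/dopen => y xy; exists (e - d x y); first by rewrite subr_gt0.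
  move=> z /= yz; apply: le_lt_trans (dT x y z) _.
  by rewrite addrC -ltrBrDr.
have nbhsE : nbhs = nbhs_ (entourage_ b).
  apply/funext => x; apply/seteqP; split=> A.
    move=> /nbhsP[e e0 eA]; exists [set xy | b xy.1 e xy.2]; first by exists e.
    by move=> y /xsectionP/= /eA.
  move=> [E [e /= e0 eE] EA]; apply/nbhsP; exists e => // y xy.
  by apply: EA; apply/xsectionP; exact: eE.
have ent_filter : Filter (entourage_ b).
  apply: filter_from_filter; first by exists 1 => /=.
  move=> e1 e2 /= e10 e20; exists (Num.min e1 e2).
    by rewrite /= lt_min e10.
  by move=> xy; rewrite /= /b lt_min => /andP.
have ent_diag A : entourage_ b A -> (diagonal `<=` A)%classic.
  by move=> [e /= e0 eA] [x y] /diagonalP/= <-; apply: eA; exact: b_center.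
have ent_inv A : entourage_ b A -> entourage_ b (A^-1)%relation.
  by move=> [e /= e0 eA]; exists e => // xy /b_sym ?; exact: eA.
have ent_split A : entourage_ b A ->
    exists2 B, entourage_ b B & ((B \; B)%relation `<=` A)%classic.
  move=> [e /= e0 eA]; exists [set xy | b xy.1 (e / 2) xy.2].
    by exists (e / 2) => //=; rewrite divr_gt0.
  move=> [x y] [z /= xz zy]; apply: eA; rewrite /= [e]splitr.
  exact: b_tri xz zy.
pose U : uniformType := HB.pack (T : Type) (Topological.class T)
  (Nbhs_isUniform_mixin.Build T ent_filter ent_diag ent_inv ent_split nbhsE).
pose M : pseudoMetricType Rdefinitions.R := HB.pack (T : Type) (Uniform.class U)
  (Uniform_isPseudoMetric.Build Rdefinitions.R U b_center b_sym b_tri erefl).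
exists M; split.
- (* records here have no definitional eta, so [erefl] does not typecheck *)
  have eta (S : topologicalType) : Topological.Pack (Topological.Class
      (Topological.topology_structure_Nbhs_isTopological_mixin
        (Topological.class S))) = S.
    by case: S => ? [].
  exact: (eta T).
- by move=> u cu; exact: dcomplete.
- rewrite ball_hausdorff => x y /eqP xy.
  have dxy : 0 < d x y.
    rewrite lt_neqAle eq_sym; apply/andP; split; first by apply/eqP => /d0.
    have := dT x y x; rewrite (d0 x x).2// (dC y x) -mulr2n.
    by rewrite pmulrn_lge0.
  have e0 : 0 < d x y / 2 by rewrite divr_gt0.
  exists (PosNum e0, PosNum e0); apply/eqP; rewrite -subset0 => z /= [xz yz].
  suff : d x y < d x y by rewrite ltxx.
  apply: le_lt_trans (dT x z y) _; rewrite [ltRHS]splitr.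
  by apply: ltrD => //; rewrite dC.
Qed.

(** * Subspaces *)

Section SetType.
Context {T : topologicalType}.
Implicit Types C : set T.

Lemma set_val_continuous C : continuous (set_val : C -> T).
Proof. exact: initial_continuous. Qed.

Lemma compact_set_type C : compact C -> compact [set: C].
Proof.
move=> cC F PF _.
have FC : (set_val @ F) C.
  by apply: (@filterS _ F _ setT) => [x _|]; [exact: set_valP|exact: filterT].
have [p [Cp clp]] := cC _ _ FC.
exists (SigSub (mem_set Cp)); split=> // P Q FP [_ [[W oW <-] /= Wp WQ]].
have fP : (set_val @ F) (set_val @` P).
  by apply: (@filterS _ F _ P) => // x Px; exists x.
have [_ [[x Px <-] Wx]] := clp _ _ fP (open_nbhs_nbhs (conj oW Wp)).
by exists x; split=> //; exact: WQ.
Qed.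

Lemma hausdorff_set_type C : hausdorff_space T -> hausdorff_space C.
Proof.
move=> hT p q clpq; apply: val_inj; apply: hT => P Q Pp Qq.
have [x [Px Qx]] := clpq _ _ (set_val_continuous Pp) (set_val_continuous Qq).
by exists (val x).
Qed.

(** An open set meeting [closure U] meets [U] in a nonempty open set, which the closure of a nowhere
    dense set cannot contain. For other closed subspaces, such as a nowhere dense singleton, the
    conclusion can fail. *)
Lemma meager_set_val (U A : set T) : open U -> meager A ->
  meager ((set_val : closure U -> T) @^-1` A).
Proof.
move=> oU [F [ndF AF]]; exists (fun n => set_val @^-1` F n); split; last first.
  by move=> x /AF[n _ Fx]; exists n.
move=> n; apply: (@nowhere_denseS _ _ (set_val @^-1` closure (F n))).
  by move=> x Fx; exact: subset_closure.
apply: closed_nowhere_dense.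
  apply: preimage_closed; last exact: closed_closure.
  by move=> x _; exact: set_val_continuous.
move=> _ [W oW <-] WF; rewrite -subset0 => x /= Wx.
have [y [Uy Wy]] := set_valP x W (open_nbhs_nbhs (conj oW Wx)).
have : U `&` W = set0.
  apply: (nowhere_dense_open_sub (ndF n)) (openI oU oW) _ => z [Uz Wz].
  exact: (WF (SigSub (mem_set (subset_closure Uz)))).
by rewrite -subset0 => /(_ y); exact.
Qed.
End SetType.

(** * Polish groups and Haar meager sets *)

Local Close Scope ring_scope.

Lemma pair_continuous (S X Y : topologicalType) (f : S -> X) (g : S -> Y) :
  continuous f -> continuous g -> continuous (fun x => (f x, g x)).
Proof. by move=> cf cg x; apply: cvg_pair; [exact: cf|exact: cg]. Qed.

Section PolishGroup.
Context {T : topologicalType} (PT : polish_group T).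
Local Notation mul := (pg_mul PT).
Local Notation inv := (pg_inv PT).
Local Notation one := (pg_one PT).

Lemma pg_mulgV : right_inverse one inv mul.
Proof.
move=> x; rewrite -[LHS](pg_mul1g PT) -{1}(pg_mulVg PT (inv x)).
by rewrite -(pg_mulA PT) (pg_mulA PT (inv x)) (pg_mulVg PT) (pg_mul1g PT)
  (pg_mulVg PT).
Qed.

Lemma pg_mulg1 : right_id one mul.
Proof.
by move=> x; rewrite -(pg_mulVg PT x) (pg_mulA PT) pg_mulgV (pg_mul1g PT).
Qed.

Lemma pg_mulKg x : cancel (mul x) (mul (inv x)).
Proof. by move=> y; rewrite (pg_mulA PT) (pg_mulVg PT) (pg_mul1g PT). Qed.

Lemma pg_mulKVg x : cancel (mul (inv x)) (mul x).
Proof. by move=> y; rewrite (pg_mulA PT) pg_mulgV (pg_mul1g PT). Qed.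

Lemma pg_mulgK x : cancel (mul^~ x) (mul^~ (inv x)).
Proof. by move=> y; rewrite -(pg_mulA PT) pg_mulgV pg_mulg1. Qed.

Lemma pg_mulgKV x : cancel (mul^~ (inv x)) (mul^~ x).
Proof. by move=> y; rewrite -(pg_mulA PT) (pg_mulVg PT) pg_mulg1. Qed.

Lemma pg_invgK : involutive inv.
Proof.
by move=> x; rewrite -[RHS](pg_mulKg (inv x)) (pg_mulVg PT) pg_mulg1.
Qed.

Lemma pg_inv1 : inv one = one.
Proof. by rewrite -[LHS]pg_mulg1 (pg_mulVg PT). Qed.

Lemma pg_invgM x y : inv (mul x y) = mul (inv y) (inv x).
Proof.
rewrite -[RHS](pg_mulKg (mul x y)) (pg_mulA PT (mul x y)).
by rewrite -(pg_mulA PT x) pg_mulgV pg_mulg1 pg_mulgV pg_mulg1.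
Qed.

Lemma translateE x (A : set T) y :
  translate mul x A y = (fun z => mul (mul (inv x) z) (inv y)) @^-1` A.
Proof.
apply/seteqP; split=> [_ [a Aa <-]|z Az] /=.
  by rewrite (pg_mulA PT) pg_mulKg pg_mulgK.
exists (mul (mul (inv x) z) (inv y)) => //.
by rewrite (pg_mulA PT) pg_mulKVg pg_mulgKV.
Qed.

Lemma pg_continuousM (S : topologicalType) (f g : S -> T) :
  continuous f -> continuous g -> continuous (fun x => mul (f x) (g x)).
Proof.
move=> cf cg x.
apply: (@continuous_comp _ _ _ (fun x => (f x, g x)) (fun p => mul p.1 p.2)).
  exact: pair_continuous.
exact: pg_mul_cont.
Qed.

Lemma pg_continuousV (S : topologicalType) (f : S -> T) :
  continuous f -> continuous (fun x => inv (f x)).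
Proof.
by move=> cf x; apply: continuous_comp; [exact: cf|exact: pg_inv_cont].
Qed.

Lemma continuous_translate (S : topologicalType) (f : S -> T) x y :
  continuous f -> continuous (fun s => mul (mul x (f s)) y).
Proof.
move=> cf; apply: pg_continuousM; last by move=> ?; exact: cvg_cst.
by apply: pg_continuousM => // ?; exact: cvg_cst.
Qed.

Lemma meager_translate x A y : meager A -> meager (translate mul x A y).
Proof.
rewrite translateE.
apply: (@meager_preimage _ _ _ (fun z => mul (mul x z) y)).
- by apply: continuous_translate => ?; exact: cvg_id.
- by apply: continuous_translate => ?; exact: cvg_id.
- by move=> z; rewrite (pg_mulA PT) pg_mulKVg pg_mulgKV.
- by move=> z; rewrite (pg_mulA PT) pg_mulKg pg_mulgK.
Qed.
End PolishGroup.

Lemma prod_translateE (G H : topologicalType) (PG : polish_group G)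
    (PH : polish_group H) p (A : set (G * H)) q :
  translate (prod_mul PG PH) p A q =
  [set z | A (pg_mul PG (pg_mul PG (pg_inv PG p.1) z.1) (pg_inv PG q.1),
              pg_mul PH (pg_mul PH (pg_inv PH p.2) z.2) (pg_inv PH q.2))].
Proof.
apply/seteqP; split=> [_ [[a b] Aab <-]|[z1 z2] /= Az] /=.
  by rewrite /prod_mul /= -!pg_mulA !pg_mulKg !pg_mulgV !pg_mulg1.
exists (pg_mul PG (pg_mul PG (pg_inv PG p.1) z1) (pg_inv PG q.1),
        pg_mul PH (pg_mul PH (pg_inv PH p.2) z2) (pg_inv PH q.2)) => //.
by rewrite /prod_mul /= -!pg_mulA !pg_mulKVg !pg_mulVg !pg_mulg1.
Qed.

Lemma polish_pseudoMetric (T : topologicalType) : polish_group T ->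
  exists M : pseudoMetricType Rdefinitions.R,
    [/\ M = T :> topologicalType, cauchy_complete M & hausdorff_space M].
Proof.
by move=> PT; have [d /pseudoMetric_of_metric] := pg_complete_metrizable PT.
Qed.

Lemma polish_baire (T : topologicalType) : polish_group T -> baire_space T.
Proof.
by move=> /polish_pseudoMetric[M [<- cM _]]; exact: baire_category.
Qed.

Lemma polish_second_countable (T : topologicalType) :
  polish_group T -> @second_countable T.
Proof.
move=> PT; have [D cD dD] := pg_separable PT.
have [M [eM _ _]] := polish_pseudoMetric PT; subst T.
exact: separable_second_countable cD dD.
Qed.

(** * Haar meager sets in product groups *)

Section Haar.
Context {G H : topologicalType} (PG : polish_group G) (PH : polish_group H).
Implicit Types B : set (G * H).

Lemma haar_meager_prod B (E : set H) (K : pseudoMetricType Rdefinitions.R)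
    (f : K -> G) : Borel B -> haar_meager (pg_mul PH) E ->
  nonempty_compact_metric K -> continuous f ->
  (forall h, ~ E h -> forall g1 g2,
    meager (f @^-1` translate (pg_mul PG) g1 (hsection B h) g2)) ->
  haar_meager (prod_mul PG PH) B.
Proof.
move=> BB [E' [BE' EE'] [L [phi [[L0 cL hL] cphi mphi]]]] [K0 cK hK] cf mf.
exists B; first by split.
exists (K * L)%type, (fun kl => (f kl.1, phi kl.2)); split.
- split.
  + by have [[k _] [l _]] := (K0, L0); exists (k, l).
  + by rewrite -setXTT; exact: compact_setX.
  + move=> [k l] [k' l'] cl; congr pair.
      apply: hK => P Q Pk Qk'.
      have [[a b] [/= Pa Qa]] := cl (fst @^-1` P) (fst @^-1` Q)
        (cvg_fst Pk) (cvg_fst Qk').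
      by exists a.
    apply: hL => P Q Pl Ql'.
    have [[a b] [/= Pb Qb]] := cl (snd @^-1` P) (snd @^-1` Q)
      (cvg_snd Pl) (cvg_snd Ql').
    by exists b.
- apply: pair_continuous => kl; apply: continuous_comp.
  + exact: cvg_fst.
  + exact: cf.
  + exact: cvg_snd.
  + exact: cphi.
move=> p q; rewrite prod_translateE.
apply: meager_of_hsection.
- exact: compact_pseudometric_second_countable.
- exact/baire_category/compact_cauchy_complete.
- exact/baire_category/compact_cauchy_complete.
- apply: Borel_baire_property; apply: Borel_preimage BB => /=.
  apply: pair_continuous.
    apply: continuous_translate.
    by move=> kl; apply: continuous_comp; [exact: cvg_fst|exact: cf].
  apply: continuous_translate.
  by move=> kl; apply: continuous_comp; [exact: cvg_snd|exact: cphi].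
(* The section at [l] is the preimage under [f] of a translate of a section of [B], taken at a point
   of [E] only if [phi l] lies in the translate of [E'] by [p.2] and [q.2]. *)
- apply: meagerS (mphi p.2 q.2) => l /=; rewrite translateE /=.
  apply: contra_notP => nE.
  by have := mf _ (fun h => nE (EE' _ h)) p.1 q.1; rewrite translateE.
Qed.

Lemma haar_meager_hsection B : haar_meager (prod_mul PG PH) B ->
  exists2 E : set H, haar_meager (pg_mul PH) E &
    forall h, ~ E h -> meager (hsection B h).
Proof.
move=> [B' [BB' sBB'] [L [phi [[L0 cL hL] cphi mphi]]]].
have cG := polish_second_countable PG; have bG := polish_baire PG.
(* Built from the Borel hull [B'] rather than from [B], this set is Borel and serves as its own
   hull. *)
exists [set h | ~ meager (hsection B' h)]; last first.
  by move=> h /= /contrapT; apply: meagerS => g; exact: sBB'.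
exists [set h | ~ meager (hsection B' h)].
  split=> //; have := Borel_nonmeager_hsection cG bG BB' openT.
  by under eq_set do rewrite setIT.
have cphi1 : continuous (fun l => (phi l).1).
  by move=> l; apply: continuous_comp; [exact: cphi|exact: cvg_fst].
have cphi2 : continuous (fun l => (phi l).2).
  by move=> l; apply: continuous_comp; [exact: cphi|exact: cvg_snd].
exists L, (fun l => (phi l).2); split=> // x y.
pose t l := pg_mul PH (pg_mul PH (pg_inv PH x) (phi l).2) (pg_inv PH y).
(* Sections of [A] at fixed [g] are preimages under [phi] of translates of [B'] by [(g, x)] and
   [(1, y)]; those at fixed [l] are homeomorphic to [hsection B' (t l)]. *)
pose A := [set lg : L * G |
  B' (pg_mul PG (pg_inv PG lg.2) (phi lg.1).1, t lg.1)].
have mA : meager A.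
  apply: meager_of_hsection.
  - exact: compact_pseudometric_second_countable.
  - exact/baire_category/compact_cauchy_complete.
  - exact: bG.
  - apply: Borel_baire_property; apply: Borel_preimage BB' => /=.
    apply: pair_continuous.
      apply: pg_continuousM.
        by apply: pg_continuousV => lg; exact: cvg_snd.
      move=> lg; apply: (@continuous_comp _ _ _ fst (fun l => (phi l).1)).
        exact: cvg_fst.
      exact: cphi1.
    apply: continuous_translate.
    move=> lg; apply: (@continuous_comp _ _ _ fst (fun l => (phi l).2)).
      exact: cvg_fst.
    exact: cphi2.
  - rewrite (_ : [set _ | _] = set0); first exact: meager0.
    rewrite -subset0 => g; apply.
    have := mphi (g, x) (pg_one PG, y); rewrite prod_translateE/=.
    by apply: meagerS => l; rewrite /hsection /A /= pg_inv1 pg_mulg1.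
(* [hsection] fixes the second coordinate, so the factors are swapped in order to fix [l] instead of
   [g]. *)
have cswap (S T : topologicalType) : continuous (fun p : S * T => (p.2, p.1)).
  by apply: pair_continuous => p; [exact: cvg_snd|exact: cvg_fst].
have mAs : meager ((fun p : G * L => (p.2, p.1)) @^-1` A).
  by apply: (meager_preimage (cswap G L) (cswap L G)) mA; case.
apply: meagerS (meager_hsection cG mAs) => l; rewrite /= translateE /= => nm ms.
apply: nm; rewrite -/(t l).
(* The substitution [g = (phi l).1 * u^-1] turns [g^-1 * (phi l).1] into [u], and hence the section
   of [A] at [l] into a section of [B']. *)
apply: (meagerS _ (@meager_preimage _ _
  (fun u => pg_mul PG (phi l).1 (pg_inv PG u))
  (fun g => pg_mul PG (pg_inv PG g) (phi l).1) _ _ _ _ _ ms)).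
- move=> u; rewrite /hsection /= /A /=.
  by rewrite pg_invgM pg_invgK pg_mulgKV.
- apply: pg_continuousM; first by move=> ?; exact: cvg_cst.
  by apply: pg_continuousV => ?; exact: cvg_id.
- apply: pg_continuousM; last by move=> ?; exact: cvg_cst.
  by apply: pg_continuousV => ?; exact: cvg_id.
- by move=> u; rewrite pg_invgM pg_invgK pg_mulgKV.
- by move=> g; rewrite pg_invgM pg_invgK pg_mulKVg.
Qed.
End Haar.

Lemma locally_compact_witness (G : topologicalType) (PG : polish_group G) :
  locally_compact [set: G] ->
  exists (K : pseudoMetricType Rdefinitions.R) (f : K -> G),
    [/\ nonempty_compact_metric K, continuous f &
      forall A, meager A -> meager (f @^-1` A)].
Proof.
have [M [eM _ hM]] := polish_pseudoMetric PG; subst G.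
move=> lcM; have [U nU [cU clU]] := lcM (pg_one PG) I.
have U1 : (U°) (pg_one PG).
  by apply: (@filterS _ (nbhs (pg_one PG)) _ _ _ _ nU) => x; apply.
(* The closure of the interior replaces [U], since a compact neighbourhood may have a part, such as
   an extra point, that is nowhere dense in the group but not meager in [U]. *)
exists (closure U° : Type), set_val; split.
- split.
  + by exists (SigSub (mem_set (subset_closure U1))).
  + apply: compact_set_type; apply: subclosed_compact cU _.
      exact: closed_closure.
    apply: subset_trans (closureS (@interior_subset _ U)) _.
    by rewrite -(closure_id U).1.
  + exact: hausdorff_set_type.
- exact: set_val_continuous.
- by move=> A; apply: meager_set_val; exact: open_interior.
Qed.

Unset Implicit Arguments.
Theorem theorem5p5 (G H : topologicalType) (PG : polish_group G)
    (PH : polish_group H) (B : set (G * H)) (HB : Borel B) :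
  let cond1 :=
    exists2 E : set H, haar_meager (pg_mul PH) E &
    exists (K : pseudoMetricType Rdefinitions.R) (f : K -> G),
      [/\ nonempty_compact_metric K, continuous f &
          forall h : H, ~ E h -> forall g1 g2 : G,
            meager (f @^-1` translate (pg_mul PG) g1 (hsection B h) g2)] in
  let cond2 := haar_meager (prod_mul PG PH) B in
  let cond3 :=
    exists2 E : set H, haar_meager (pg_mul PH) E &
      forall h : H, ~ E h -> meager (hsection B h) in
  (cond1 -> cond2) /\
  (locally_compact [set: G] -> (cond1 <-> cond2) /\ (cond2 <-> cond3)).
Proof.
move=> cond1 cond2 cond3.
have c12 : cond1 -> cond2.
  by move=> [E hE [K [f [hK cf mf]]]]; exact: haar_meager_prod hE hK cf mf.
have c23 : cond2 -> cond3 by exact: haar_meager_hsection.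
split=> // lcG.
have c31 : cond3 -> cond1.
  move=> [E hE mE]; exists E => //.
  have [K [f [hK cf mf]]] := locally_compact_witness PG lcG.
  exists K, f; split=> // h nEh g1 g2.
  by apply: mf; apply: meager_translate; exact: mE.
by split; split=> // ?; [exact/c31/c23|exact/c12/c31].
Qed.
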